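(* Let $n>1$ be an integer all of whose components are congruent to $1$ modulo $4$. Then there exists a doubly disjoint $(\mathbb Z_3\times V_n,\mathbb Z_3\times\{0\},3,1)$ difference family.
   Context: A component of an integer is a maximal prime power dividing it. For $N$ with components $q_1,\dots,q_\omega$, $V_N$ is the additive group of $\mathbb F_{q_1}\times\dots\times\mathbb F_{q_\omega}$. For a subgroup $H$ of an abelian group $G$, a $(G,H,3,1)$ difference family is a family $\mathcal F$ of $3$-subsets of $G$ such that the multiset of differences $x-y$, over ordered pairs of distinct elements of a common block, equals $G\setminus H$ (each element exactly once). Two such families are strongly equivalent if each block of one is a translate $B+t$ of a block $B$ of the other (blocks in one-to-one correspondence). A $(G,H,3,1)$ difference family $\mathcal F$ is doubly disjoint if there is a $(G,H,3,1)$ difference family $\mathcal F'$ strongly equivalent to $\mathcal F$ such that the blocks of $\mathcal F$ together with those of $\mathcal F'$ form a partition of $G\setminus H$. *)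

(* Defs.v *)
From HB Require Import structures.
From mathcomp Require Import all_boot all_algebra all_field.

Set Implicit Arguments.
Unset Strict Implicit.
Unset Printing Implicit Defensive.

Import GRing.Theory.
Local Open Scope ring_scope.

Definition components (n : nat) : seq nat :=
  [seq (p ^ logn p n)%N | p <- primes n].

Section VN.
Variable n : nat.

(* The components of n are indexed by its prime divisors. *)
Notation prime_divisor := (seq_sub (primes n)).

Fact prime_divisor_prime (p : prime_divisor) : prime (ssval p).
Proof. by have := ssvalP p; rewrite mem_primes => /andP[]. Qed.

Fact prime_divisor_logn_gt0 (p : prime_divisor) : (0 < logn (ssval p) n)%N.
Proof. by rewrite logn_gt0 ssvalP. Qed.

(* The finite field of order p ^ logn p n. *)
Definition component_field (p : prime_divisor) : finFieldType :=
  s2val (pPrimePowerField (prime_divisor_prime p) (prime_divisor_logn_gt0 p)).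

Fact card_component_field (p : prime_divisor) :
  #|component_field p| = (ssval p ^ logn (ssval p) n)%N.
Proof. exact: s2valP' (pPrimePowerField _ _). Qed.

Definition V : predArgType := {dffun forall p : prime_divisor, component_field p}.

HB.instance Definition _ := Finite.on V.

Definition V_zero : V := [ffun p => 0 : component_field p].
Definition V_opp (u : V) : V := [ffun p => - u p].
Definition V_add (u v : V) : V := [ffun p => u p + v p].

Fact V_addA : associative V_add.
Proof. by move=> u v w; apply/ffunP => p; rewrite !ffunE addrA. Qed.
Fact V_addC : commutative V_add.
Proof. by move=> u v; apply/ffunP => p; rewrite !ffunE addrC. Qed.
Fact V_add0 : left_id V_zero V_add.
Proof. by move=> u; apply/ffunP => p; rewrite !ffunE add0r. Qed.
Fact V_addN : left_inverse V_zero V_opp V_add.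
Proof. by move=> u; apply/ffunP => p; rewrite !ffunE addNr. Qed.

HB.instance Definition _ :=
  GRing.isZmodule.Build V V_addA V_addC V_add0 V_addN.

End VN.

(* The library equips a product only separately with its finType and zmodType
   structures; this declares their join. *)
HB.instance Definition _ (U W : finZmodType) := GRing.Zmodule.on (U * W)%type.

Section DifferenceFamilies.
Variable G : finZmodType.
Implicit Types (H B : {set G}) (F : seq {set G}).

Definition block_differences B : seq G :=
  [seq xy.1 - xy.2 | xy <- enum (setX B B) & xy.1 != xy.2].

Definition differences F : seq G := flatten [seq block_differences B | B <- F].

(* A (G, H, 3, 1) difference family; a family of blocks is a sequence, to be
   read up to reordering. *)
Definition difference_family H F : Prop :=
  [/\ zmod_closed (mem H),
      {in F, forall B, #|B| = 3%N}
    & perm_eq (differences F) (enum (~: H))].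

Definition is_translate B B' : bool :=
  [exists t : G, B' == [set x + t | x in B]].

(* The reordering F1 of F' encodes the one-to-one correspondence of blocks. *)
Definition strongly_equivalent F F' : Prop :=
  exists2 F1, perm_eq F1 F' & all2 is_translate F F1.

Definition doubly_disjoint H F : Prop :=
  exists F', [/\ difference_family H F',
                 strongly_equivalent F F',
                 uniq (F ++ F')
               & partition [set:: F ++ F'] (~: H)].

End DifferenceFamilies.

(* Main.v *)
Require Import Defs.
From HB Require Import structures.
From mathcomp Require Import all_boot all_algebra all_field fingroup cyclic.

(** Write [i] for an element of square [-1] in the product of the fields.  For
    [u != 0] take the block [{(a, u + iu), (a, u - iu), (2, u)}] of
    [Z_3 * V_n], with [a] in [{0, 1}].  Whatever [a] is, its differences are
    [(0, ±2iu)], [(1, ±iu)] and [(2, ±iu)], so letting [u] run over a set of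
    representatives of the nonzero elements up to sign gives a difference
    family; the opposite representatives give translates of the same blocks, as
    soon as [a] is an even function of [u].  All these blocks are disjoint if
    moreover [a (iu) != a u]: a point [(0, v)] or [(1, v)] can only lie in the
    blocks of [v / (1 + i)] and [v / (1 - i) = i v / (1 + i)]. *)

Set Implicit Arguments.
Unset Strict Implicit.
Unset Printing Implicit Defensive.

Import GRing.Theory.
Local Open Scope ring_scope.

(** * Differences within one block *)

Section BlockDifferences.
Variables (G : finZmodType) (B : {set G}).

(** Ordered pairs of distinct elements form the square of [B] minus its diagonal [D]. This count
    later turns coverage of a set by differences into exact coverage. *)
Lemma size_block_differences :
  size (block_differences B) = (#|B| * #|B| - #|B|)%N.
Proof.
pose D := [set (x, x) | x in B].
have cardD : #|D| = #|B| by rewrite card_imset // => x y [].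
have sDB : D \subset setX B B.
  by apply/subsetP => _ /imsetP[x xB ->]; rewrite in_setX /= xB.
rewrite size_map -cardsX -cardD -cardsDS // cardE.
apply/perm_size/uniq_perm; first exact/filter_uniq/enum_uniq.
  exact: enum_uniq.
move=> [x y]; rewrite mem_filter !mem_enum in_setD /=.
have [xyB|] := boolP ((x, y) \in setX B B); rewrite ?andbF // !andbT.
congr (~~ _); apply/eqP/imsetP => [xy|[z _ [-> ->]] //].
by move: xyB; rewrite in_setX xy => /andP[/= yB _]; exists y.
Qed.

Lemma mem_block_differences x y :
  x \in B -> y \in B -> x != y -> x - y \in block_differences B.
Proof.
move=> xB yB xy; apply/mapP; exists (x, y) => //.
by rewrite mem_filter mem_enum in_setX /= xy xB.
Qed.

Lemma block_differencesN d :
  d \in block_differences B -> - d \in block_differences B.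
Proof.
case/mapP => -[x y]; rewrite mem_filter mem_enum in_setX /=.
case/and3P => xy xB yB ->; rewrite opprB.
by apply: mem_block_differences; rewrite // eq_sym.
Qed.

End BlockDifferences.

(** * Representatives of the nonzero elements up to sign *)

Section HalfSet.
Variable W : finZmodType.
Hypothesis dblI : forall v : W, v + v = 0 -> v = 0.

Lemma opp_neq (v : W) : v != 0 -> v != - v.
Proof.
by apply: contra_neq => /eqP vN; apply: dblI; apply/eqP; rewrite addr_eq0.
Qed.

Definition half_set : seq W := enum [set v : W | (enum_rank v < enum_rank (- v))%N].

(** The ranks of [v] and [- v] differ exactly when [v] is nonzero, so one element of each such pair
    is selected. *)
Lemma half_setP : perm_eq (half_set ++ map -%R half_set) (enum [set~ 0 : W]).
Proof.
have memN v : (v \in map -%R half_set) = (- v \in half_set).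
  by rewrite -{1}[v]opprK mem_map //; apply: oppr_inj.
apply: uniq_perm; rewrite ?enum_uniq //.
  rewrite cat_uniq map_inj_uniq ?enum_uniq /=; last exact: oppr_inj.
  rewrite andbT; apply/hasPn => v; rewrite memN !mem_enum !inE opprK.
  by rewrite -leqNgt => /ltnW.
move=> v; rewrite mem_cat memN !mem_enum !inE opprK.
rewrite -neq_ltn; have [->|/opp_neq] := eqVneq v 0; first by rewrite oppr0 eqxx.
by apply: contra_neqT; rewrite negbK => /eqP/val_inj/enum_rank_inj.
Qed.

End HalfSet.

(** * Blocks built from a square root [J] of -1 *)

Section Blocks.
Variables (W : finZmodType) (J : {additive W -> W}).
Hypothesis dblI : forall v : W, v + v = 0 -> v = 0.
Hypothesis JJ : forall v, J (J v) = - v.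

(** Serves as a label of the unordered pair of [v] and [- v]. *)
Let rk (v : W) := minn (enum_rank v) (enum_rank (- v)).

Lemma rkN v : rk (- v) = rk v. Proof. by rewrite /rk opprK minnC. Qed.

Lemma rk_inj u v : rk u = rk v -> u = v \/ u = - v.
Proof.
rewrite /rk /minn; case: ifP => _; case: ifP => _ /val_inj/enum_rank_inj.
- by left.
- by right.
- by move=> <-; right; rewrite opprK.
- by move/oppr_inj; left.
Qed.

Lemma J_eq0 v : (J v == 0) = (v == 0).
Proof.
apply/eqP/eqP => [Jv|->]; last by rewrite raddf0.
by apply/eqP; rewrite -oppr_eq0 -JJ Jv raddf0.
Qed.

(** If [J u] were [u] or [- u], applying [J] once more would give [u = - u]. *)
Lemma J_neq u : u != 0 -> rk (J u) != rk u.
Proof.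
move=> u0; apply: contra_neq (opp_neq dblI u0) => /rk_inj[] Ju.
  by rewrite -JJ !Ju.
by rewrite -JJ Ju raddfN Ju opprK.
Qed.

(** The function [a] of the construction. Comparing labels of pairs makes it even, and [J] reverses
    the comparison since [J (J u) = - u] has the label of [u]. *)
Definition lev (u : W) : 'Z_3 := if (rk u < rk (J u))%N then 0 else 1.

Lemma levN u : lev (- u) = lev u.
Proof. by rewrite /lev raddfN !rkN. Qed.

Lemma levJ u : u != 0 -> lev (J u) = 1 - lev u.
Proof.
move=> /J_neq uJ; rewrite /lev JJ rkN.
by case: ltngtP uJ => //; rewrite ?subrr ?subr0.
Qed.

Lemma lev01 u : lev u = 0 \/ lev u = 1.
Proof. by rewrite /lev; case: ifP => _; [left|right]. Qed.

Definition block (u : W) : {set 'Z_3 * W} :=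
  [set (lev u, u + J u); (lev u, u - J u); (2%:R, u)].

Lemma lev_neq2 u : (lev u == 2%:R) = false.
Proof. by case: (lev01 u) => ->. Qed.

Lemma block_inj : injective block.
Proof.
move=> u v uv; have: (2%:R, u) \in block v by rewrite -uv !inE eqxx !orbT.
by rewrite !inE !xpair_eqE ![2%:R == lev _]eq_sym !lev_neq2 /= => /eqP.
Qed.

Lemma card_block u : u != 0 -> #|block u| = 3%N.
Proof.
move=> u0; rewrite /block setUC cardsU1 cards2 !inE !xpair_eqE.
rewrite ![2%:R == lev _]eq_sym !lev_neq2 eqxx /=.
by rewrite (inj_eq (addrI u)) opp_neq // J_eq0.
Qed.

Lemma block_translate u : is_translate (block u) (block (- u)).
Proof.
(* The shift by [- 2u] sends [u + J u] to [- u - J (- u)] and [u - J u] to [- u + J (- u)], so the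
   first two points swap roles. *)
apply/existsP; exists (0, - u - u); apply/eqP.
rewrite /block levN raddfN !imsetU !imset_set1 opprK.
have addp (a : 'Z_3) (x y : W) : (a, x) + (0, y) = (a, x + y).
  by apply/pair_equal_spec; rewrite /= addr0.
rewrite !addp [X in X :|: _]setUC; congr (_ :|: _ :|: _); congr [set (_, _)].
- by rewrite addrACA addrA subrr add0r addrC.
- by rewrite addrACA addrA subrr add0r addrC.
- by rewrite addrA subrr add0r.
Qed.

Let H : {set 'Z_3 * W} := setX [set: 'Z_3] [set 0].

Lemma mem_setCH c v : ((c, v) \in ~: H) = (v != 0).
Proof. by rewrite in_setC in_setX !inE. Qed.

Lemma card_setCH : #|~: H| = (3 * #|[set~ 0%R : W]|)%N.
Proof.
have -> : ~: H = setX [set: 'Z_3] [set~ 0].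
  by apply/setP => -[c v]; rewrite mem_setCH in_setX !inE.
by rewrite cardsX cardsT card_ord.
Qed.

(** Applying [J] to the hypothesis gives [J z = z], hence [z + z = 0]. *)
Lemma addJ_eq0 (z : W) : z + J z = 0 -> z = 0.
Proof.
move=> zJ; have := congr1 J zJ; rewrite raddfD JJ raddf0 => /eqP.
by rewrite subr_eq0 => /eqP Jz; apply: dblI; rewrite -{2}Jz.
Qed.

Lemma addJ_onto v : exists u, v = u + J u.
Proof.
have inj : injective (fun u => u + J u).
  move=> x y /= xy; apply/eqP; rewrite -subr_eq0; apply/eqP/addJ_eq0.
  by rewrite raddfB addrACA -opprD xy subrr.
by have [g _ Kg] := injF_bij inj; exists (g v); rewrite /= Kg.
Qed.

Lemma dblJ_onto v : exists u, v = J u + J u.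
Proof.
have inj : injective (fun u => J u + J u).
  move=> x y /= xy; apply/eqP; rewrite -subr_eq0 -J_eq0; apply/eqP/dblI.
  by rewrite raddfB addrACA -opprD xy subrr.
by have [g _ Kg] := injF_bij inj; exists (g v); rewrite /= Kg.
Qed.

(** For [v = u + J u], also [v = J u - J (J u)]. Hence [block u] and [block (J u)] contain [v] at
    the levels [lev u] and [1 - lev u], which exhaust 0 and 1, while [block v] covers level 2. *)
Lemma mem_blocks c v : v != 0 -> exists2 u, u != 0 & (c, v) \in block u.
Proof.
move=> v0; have [u Dv] := addJ_onto v.
have u0 : u != 0 by apply: contra_neq v0 => u0; rewrite Dv u0 raddf0 addr0.
have [->|c2] := eqVneq c 2%:R; first by exists v; rewrite // !inE eqxx !orbT.
have [cu|cu] := eqVneq c (lev u).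
  by exists u => //; rewrite !inE cu Dv eqxx.
have cJ : c = 1 - lev u.
  by case: (lev01 u) c2 cu => ->; case: c => [[|[|[|?]]] ?] //= _ _; apply/val_inj.
exists (J u); first by rewrite J_eq0.
by rewrite !inE levJ // cJ JJ opprK Dv [u + _]addrC eqxx orbT.
Qed.

Lemma block_subset u : u != 0 -> block u \subset ~: H.
Proof.
move=> u0; apply/subsetP => -[c v]; rewrite mem_setCH !inE !xpair_eqE.
case/orP => [/orP[]|] /andP[_ /eqP->] //.
  by apply: contra_neq u0; apply: addJ_eq0.
have -> : u - J u = - (J u + J (J u)) by rewrite JJ opprB.
by rewrite oppr_eq0; apply: contra_neq u0 => /addJ_eq0/eqP; rewrite J_eq0 => /eqP.
Qed.

Lemma mem_block_diff1 c u :
  c != 0 -> u != 0 -> (c, J u) \in block_differences (block u).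
Proof.
move=> c0 u0; have subp (a b : 'Z_3) (x y : W) : (a, x) - (b, y) = (a - b, x - y).
  by [].
(* As [lev u] is 0 or 1, these two opposite values are the nonzero elements of ['Z_3]. *)
have [->|->] : c = lev u - 2%:R \/ c = 2%:R - lev u.
  by case: (lev01 u) => ->; case: c c0 => [[|[|[|?]]] ?] //= _;
    (left; exact/val_inj) || (right; exact/val_inj).
- have -> : (lev u - 2%:R, J u) = (lev u, u + J u) - (2%:R, u).
    by rewrite subp [u + _]addrC addrK.
  by apply: mem_block_differences; rewrite ?inE ?eqxx ?orbT // xpair_eqE lev_neq2.
- have -> : (2%:R - lev u, J u) = (2%:R, u) - (lev u, u - J u).
    by rewrite subp opprB [J u - _]addrC addNKr.
  apply: mem_block_differences; rewrite ?inE ?eqxx ?orbT // xpair_eqE eq_sym.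
  by rewrite lev_neq2.
Qed.

Lemma mem_block_diff0 u :
  u != 0 -> (0, J u + J u) \in block_differences (block u).
Proof.
move=> u0; have -> : (0, J u + J u) = (lev u, u + J u) - (lev u, u - J u).
  apply/pair_equal_spec; split; rewrite /= ?subrr //.
  by rewrite opprB [J u - u]addrC addrACA subrr add0r.
apply: mem_block_differences; rewrite ?inE ?eqxx ?orbT //.
by rewrite xpair_eqE eqxx (inj_eq (addrI u)) opp_neq // J_eq0.
Qed.

Lemma zmod_closed_H : zmod_closed (mem H).
Proof.
split=> [|[a x] [b y]]; rewrite /= !inE //=.
by move=> /eqP-> /eqP->; rewrite subr0.
Qed.

(** * The difference family given by representatives up to sign *)

Section Family.
Variable s : seq W.
Hypothesis sP : perm_eq (s ++ map -%R s) (enum [set~ 0 : W]).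

Lemma mem_half v : (v \in s) || (- v \in s) = (v != 0).
Proof.
have := perm_mem sP v; rewrite mem_cat mem_enum !inE => <-; congr (_ || _).
by rewrite -{2}[v]opprK mem_map //; apply: oppr_inj.
Qed.

Lemma half_neq0 v : v \in s -> v != 0.
Proof. by move=> vs; rewrite -mem_half vs. Qed.

Lemma card_nonzero : #|[set~ 0 : W]| = (2 * size s)%N.
Proof. by rewrite cardE -(perm_size sP) size_cat size_map addnn mul2n. Qed.

Lemma size_differences : size (differences (map block s)) = #|~: H|.
Proof.
rewrite card_setCH card_nonzero mulnA size_flatten /shape -!map_comp.
have : {in s, forall u, u != 0} by move=> u; apply: half_neq0.
elim: (s) => //= u t IHt t0.
rewrite IHt => [|v vt]; last by rewrite t0 // inE vt orbT.
by rewrite size_block_differences card_block ?mulnS // t0 ?inE ?eqxx.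
Qed.

Lemma mem_differences c v : v != 0 -> (c, v) \in differences (map block s).
Proof.
move=> v0; suff [u us D] : exists2 u, u \in s & (c, v) \in block_differences (block u).
  by apply/flattenP; exists (block_differences (block u)); rewrite ?map_f.
have [->|c0] := eqVneq c 0.
  have [u Dv] := dblJ_onto v.
  have u0 : u != 0 by apply: contra_neq v0 => u0; rewrite Dv u0 raddf0 addr0.
  move: (u0); rewrite -mem_half Dv => /orP[us|us]; first by exists u; rewrite ?mem_block_diff0.
  (* When the representative is [- u], the opposite difference comes from its block, and differences
     of a block are closed under negation. *)
  exists (- u) => //; rewrite -[X in X \in _]opprK; apply: block_differencesN.
  have -> : - (0, J u + J u) = (0, J (- u) + J (- u)) :> 'Z_3 * W.
    by apply/pair_equal_spec; rewrite /= oppr0 raddfN opprD.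
  by rewrite mem_block_diff0 ?oppr_eq0.
have [u Dv] : exists u, v = J u by exists (- J v); rewrite raddfN JJ opprK.
have u0 : u != 0 by rewrite -J_eq0 -Dv.
move: (u0); rewrite -mem_half Dv => /orP[us|us]; first by exists u; rewrite ?mem_block_diff1.
exists (- u) => //; rewrite -[X in X \in _]opprK; apply: block_differencesN.
have -> : - (c, J u) = (- c, J (- u)) :> 'Z_3 * W by rewrite raddfN.
by rewrite mem_block_diff1 ?oppr_eq0.
Qed.

(** The list of differences covers the complement of [H] and has exactly its size, so nothing is
    repeated and nothing else occurs. *)
Lemma difference_family_blocks : difference_family H (map block s).
Proof.
split; first exact: zmod_closed_H.
  by move=> _ /mapP[u /half_neq0 u0 ->]; apply: card_block.
have sub : {subset enum (~: H) <= differences (map block s)}.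
  by move=> [c v]; rewrite mem_enum mem_setCH; apply: mem_differences.
have le : (size (differences (map block s)) <= size (enum (~: H)))%N.
  by rewrite size_differences cardE.
have [_ eqm] := uniq_min_size (enum_uniq _) sub le.
apply: uniq_perm (enum_uniq _) _; first exact: leq_size_uniq (enum_uniq _) sub le.
by move=> x; rewrite eqm.
Qed.

End Family.

Lemma partition_blocks : partition (block @: [set~ 0]) (~: H).
Proof.
have cov : cover (block @: [set~ 0]) = ~: H.
  apply/setP => -[c v]; apply/bigcupP/idP => [[B /imsetP[u u0 ->]]|].
    by apply/subsetP/block_subset; move: u0; rewrite !inE.
  rewrite mem_setCH => /(mem_blocks c)[u u0 cv].
  by exists (block u) => //; rewrite imset_f // !inE.
apply/and3P; split; first by rewrite cov.
  (* Disjointness by counting: the block sizes add up to the size of the union. *)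
  rewrite -(geq_leqif (leq_card_cover _)) cov card_setCH.
  rewrite big_imset /=; last by move=> u v _ _; apply: block_inj.
  rewrite (eq_bigr (fun=> 3%N)) => [|u]; last by rewrite !inE; apply: card_block.
  by rewrite sum_nat_const mulnC.
apply/imsetP => -[u]; rewrite !inE => /card_block B3 B0.
by move: B3; rewrite -B0 cards0.
Qed.

Lemma doubly_disjoint_blocks :
  exists F : seq {set 'Z_3 * W}, difference_family H F /\ doubly_disjoint H F.
Proof.
have sP := half_setP dblI; pose s := half_set W; pose t := map -%R s.
(* The opposites [t] are again representatives up to sign, so their blocks form the second
   family. *)
have tP : perm_eq (t ++ map -%R t) (enum [set~ 0 : W]).
  rewrite -map_comp map_id_in => [|v _]; last exact: opprK.
  by rewrite perm_catC.
exists (map block s); split; first exact: difference_family_blocks.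
exists (map block t); rewrite -map_cat; split.
- exact: difference_family_blocks.
- exists (map block t) => //; rewrite /t.
  by elim: (s) => //= u r ->; rewrite block_translate.
- by rewrite (map_inj_uniq block_inj) (perm_uniq sP) enum_uniq.
- suff -> : [set:: map block (s ++ t)] = block @: [set~ 0] by exact: partition_blocks.
  apply/setP => B; rewrite inE; apply/mapP/imsetP => -[u us ->]; exists u => //.
    by move: us; rewrite (perm_mem sP) mem_enum.
  by rewrite (perm_mem sP) mem_enum.
Qed.

End Blocks.

(** * Finite fields of order 1 modulo 4 *)

Lemma finField_sqrtN1 (F : finFieldType) :
  #|F| = 1 %[mod 4] -> exists i : F, i * i = -1.
Proof.
move=> F1; pose k := (#|F| %/ 4)%N.
have Fk : #|F| = (k * 4).+1 by rewrite {1}(divn_eq #|F| 4) F1 addn1.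
have k0 : (0 < k * 2)%N.
  by have := finNzRing_gt1 F; rewrite Fk; case: (k).
(* At most [2k] elements satisfy [x ^+ (k * 2) = 1], fewer than the [4k] nonzero ones. *)
have [x /andP[x0 xk]] : exists x : F, (x != 0) && (x ^+ (k * 2) != 1).
  apply/existsP; apply: contraLR isT; rewrite negb_exists => /forallP all1.
  have /(max_unity_roots k0) : all (k * 2).-unity_root (enum [set~ 0 : F]).
    apply/allP => x; rewrite mem_enum !inE unity_rootE => x0.
    by have := all1 x; rewrite x0 negbK.
  move/(_ (enum_uniq _)); rewrite -cardE cardsC1 Fk /= leqNgt.
  by rewrite ltn_pmul2l //; case: (k) k0.
(* Its square [x ^+ (k * 2)] squares to 1 without being 1, so it is -1. *)
exists (x ^+ k); rewrite -expr2 -exprM; apply/eqP.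
have : (x ^+ (k * 2)) ^+ 2 == 1.
  rewrite -exprM -mulnA; have := expf_card x; rewrite Fk exprS => /eqP.
  by rewrite -{3}[x]mulr1 (inj_eq (mulfI x0)).
by rewrite sqrf_eq1 (negPf xk).
Qed.

Lemma finField_two_neq0 (F : finFieldType) : odd #|F| -> 1 + 1 != 0 :> F.
Proof.
move=> oddF; apply: contra_neq (oner_neq0 F) => two0.
(* Lagrange in the additive group; if [1 + 1 = 0], odd order reduces this multiple to 1. *)
have : 1 *+ #|F| = 0 :> F.
  by have := @expg_cardG F [set: F]%G 1%R (in_setT _); rewrite cardsT FinRing.zmodXgE.
rewrite -(odd_double_half #|F|) oddF mulrnDr -addnn mulrnDr -mulrnDl two0.
by rewrite mul0rn addr0.
Qed.

(** * Componentwise multiplication by a square root of -1 *)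

Section Scale.
Variables (n : nat) (I : forall p : seq_sub (primes n), component_field p).

Definition V_scale (v : V n) : V n := [ffun p => I p * v p].

Fact V_scale_is_zmod_morphism : zmod_morphism V_scale.
Proof. by move=> u v; apply/ffunP => p; rewrite !ffunE mulrBr. Qed.

HB.instance Definition _ :=
  GRing.isZmodMorphism.Build (V n) (V n) V_scale V_scale_is_zmod_morphism.

End Scale.

Theorem theorem9p2 (n : nat) (n_gt1 : (1 < n)%N)
    (n_comp : forall q : nat, q \in components n -> q = 1 %[mod 4]) :
  let H : {set 'Z_3 * V n} := setX [set: 'Z_3] [set 0%R : V n] in
  exists F : seq {set 'Z_3 * V n}, difference_family H F /\ doubly_disjoint H F.
Proof.
have card1 (p : seq_sub (primes n)) : #|component_field p| = 1 %[mod 4].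
  rewrite card_component_field; apply: n_comp.
  by apply/mapP; exists (ssval p); rewrite ?ssvalP.
have sqrtN1 (p : seq_sub (primes n)) : exists i : component_field p, i * i == -1.
  by have [i ii] := finField_sqrtN1 (card1 p); exists i; apply/eqP.
pose J : {additive V n -> V n} := V_scale (fun p => xchoose (sqrtN1 p)).
apply: (@doubly_disjoint_blocks _ J) => [v vv0|v].
  apply/ffunP => p; rewrite ffunE; apply/eqP.
  have /eqP := congr1 (fun w : V n => w p) vv0.
  rewrite !ffunE -mulr2n -mulr_natl mulf_eq0 => /orP[|//].
  rewrite (negPf (finField_two_neq0 _)) //.
  by rewrite (divn_eq #|component_field p| 4) card1 oddD oddM andbF.
apply/ffunP => p; rewrite !ffunE mulrA.
by rewrite (eqP (xchooseP (sqrtN1 p))) mulN1r.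
Qed.
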